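(* Let $D_{\mathcal{A}}$ be a first (order $1$) generalized Riemann derivative without excess which is not a Gaussian Riemann derivative. Then: (i) $D_{\mathcal{A}}f(x)=f_{(1)}^s(x)$ (for every function $f$ and point $x$, one side exists if and only if the other does, and then they are equal); (ii) the existence of both $f_{(0)}(x)$ and $D_{\mathcal{A}}f(x)$ does not imply the existence of $f_{(1)}(x)$ for all $f$ and $x$; that is, there exist a function $f:\mathbb{R}\to\mathbb{R}$ and a point $x\in\mathbb{R}$ such that $f_{(0)}(x)$ and $D_{\mathcal{A}}f(x)$ exist but $f_{(1)}(x)$ does not exist.
   Context: An $n$-th generalized Riemann difference is $\Delta_{\mathcal{A}}(x,h;f)=\sum_{k=0}^{\ell}A_kf(x+a_kh)$, where the real numbers $A_k$ are non-zero, the real numbers $a_k$ are distinct, and $\sum_{k=0}^{\ell}A_ka_k^j=\delta_{j,n}\cdot n!$ for $j=0,1,\ldots ,n$ (with $0^0=1$). The points $x+a_kh$ are its base points. The associated $n$-th generalized Riemann derivative is $D_{\mathcal{A}}f(x)=\lim_{h\to 0}\Delta_{\mathcal{A}}(x,h;f)/h^n$, when this finite limit exists. It is without excess if $\ell=n$ (exactly $n+1$ base points), in which case the $a_k$ determine the $A_k$. The scale by a real $r\ne 0$ of the difference with data $\{A_k;a_k\}$ is the $n$-th generalized Riemann difference with data $\{r^{-n}A_k;ra_k\}$; a difference and its scales define the same derivative, and derivatives are identified accordingly. An $n$-th generalized Riemann derivative is Gaussian if, for some real $q\neq 0,\pm1$, up to a scale it is the $n$-th generalized Riemann derivative without excess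 based at $x,x+h,x+qh,\ldots ,x+q^{n-1}h$ or at $x+h,x+qh,\ldots ,x+q^nh$. For $n=1$ these are the base points $x,x+h$, respectively $x+h,x+qh$. Peano derivatives: $f_{(n)}(x)$ exists if there are real numbers $f_{(0)}(x):=f(x),f_{(1)}(x),\ldots ,f_{(n)}(x)$ with $f(x+h)=\sum_{i=0}^n f_{(i)}(x)\frac{h^i}{i!}+o(h^n)$ as $h\to 0$; thus $f_{(0)}(x)$ exists if and only if $f$ is continuous at $x$. The first symmetric Peano derivative $f_{(1)}^s(x)$ is the number such that $\frac12\{f(x+h)-f(x-h)\}=f_{(1)}^s(x)h+o(h)$ as $h\to 0$, if it exists. *)

(* Defs.v *)
From HB Require Import structures.
From mathcomp Require Import all_boot all_order all_algebra.
From mathcomp Require Import all_classical all_reals all_analysis.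

Set Implicit Arguments.
Unset Strict Implicit.
Unset Printing Implicit Defensive.

Import Order.TTheory GRing.Theory Num.Theory.
Import numFieldNormedType.Exports.

Local Open Scope classical_set_scope.
Local Open Scope ring_scope.

(* The data {A_k; a_k | 0 <= k <= l} of an n-th generalized Riemann
   difference: coef A k is A_k, node A k is a_k and grd_len A is l. *)
Record grdiff (R : realType) (n : nat) := GRDiff {
  grd_len : nat;
  coef : 'I_grd_len.+1 -> R;
  node : 'I_grd_len.+1 -> R;
  coef_neq0 : forall k, coef k != 0;
  node_inj : injective node;
  moments : forall j : nat, (j <= n)%N ->
    \sum_k coef k * node k ^+ j = if j == n then n`!%:R else 0 }.

Arguments coef {R n} g k.
Arguments node {R n} g k.

Definition Delta (R : realType) n (A : grdiff R n) (x h : R) (f : R -> R) : R :=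
  \sum_k coef A k * f (x + node A k * h).

Definition is_grderiv (R : realType) n (A : grdiff R n) (f : R -> R) (x L : R)
    : Prop :=
  (fun h : R => Delta A x h f / h ^+ n) @ 0^' --> L.

Definition without_excess (R : realType) n (A : grdiff R n) : Prop :=
  grd_len A = n.

Lemma scale_coef_neq0 (R : realType) n (A : grdiff R n) (r : R) (hr : r != 0) k :
  r ^- n * coef A k != 0.
Proof. by rewrite mulf_neq0 ?invr_neq0 ?expf_neq0 // coef_neq0. Qed.

Lemma scale_node_inj (R : realType) n (A : grdiff R n) (r : R) (hr : r != 0) :
  injective (fun k => r * node A k).
Proof. by move=> i j /(mulfI hr)/node_inj. Qed.

Lemma scale_moments (R : realType) n (A : grdiff R n) (r : R) (hr : r != 0)
    (j : nat) (hj : (j <= n)%N) :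
  \sum_k r ^- n * coef A k * (r * node A k) ^+ j =
    if j == n then n`!%:R else 0.
Proof.
under eq_bigr => k _ do rewrite exprMn mulrACA.
rewrite -mulr_sumr moments //.
by case: eqP => [->|_]; rewrite ?mulr0 // mulVf ?mul1r // expf_neq0.
Qed.

Definition scale (R : realType) n (r : R) (hr : r != 0) (A : grdiff R n)
    : grdiff R n :=
  @GRDiff R n (grd_len A)
    (fun k => r ^- n * coef A k) (fun k => r * node A k)
    (@scale_coef_neq0 R n A r hr) (@scale_node_inj R n A r hr)
    (@scale_moments R n A r hr).

(* The enumeration of the pairs (A_k, a_k) is immaterial. *)
Definition same_grdiff (R : realType) n (A B : grdiff R n) : Prop :=
  exists2 s : 'I_(grd_len A).+1 -> 'I_(grd_len B).+1, bijective s &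
    forall k, coef A k = coef B (s k) /\ node A k = node B (s k).

(* The base points of A are exactly the x + c h with c in the list s. *)
Definition based_at (R : realType) n (A : grdiff R n) (s : seq R) : Prop :=
  codom (node A) =i s.

Definition gaussian (R : realType) n (A : grdiff R n) : Prop :=
  exists q : R, [/\ q <> 0, q <> 1 & q <> - 1] /\
  exists B : grdiff R n,
    [/\ without_excess B,
        based_at B (0 :: mkseq (fun i => q ^+ i) n) \/
        based_at B (mkseq (fun i => q ^+ i) n.+1)
      & exists (r : R) (hr : r != 0), same_grdiff A (scale hr B)].

(* c i is the i-th Peano derivative of f at x for i <= n; the values c i with
   i > n play no role. *)
Definition is_peano (R : realType) (n : nat) (f : R -> R) (x : R)
    (c : nat -> R) : Prop :=
  c 0%N = f x /\
  (fun h : R => f (x + h) - \sum_(i < n.+1) c i * (h ^+ i / i`!%:R))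
    =o_ (0 : R) (fun h : R => h ^+ n).

Definition peano_exists (R : realType) (n : nat) (f : R -> R) (x : R) : Prop :=
  exists c : nat -> R, is_peano n f x c.

Definition is_sym_peano1 (R : realType) (f : R -> R) (x s : R) : Prop :=
  (fun h : R => 2^-1 * (f (x + h) - f (x - h)) - s * h)
    =o_ (0 : R) (fun h : R => h).

(* Main.v *)
(** A first difference without excess has two nodes a <> b, and its coefficients
    are forced: it is (f(x + b h) - f(x + a h)) / (b - a).  If one node is 0, or
    if b / a <> -1, a scale of it is visibly Gaussian.  The only remaining case
    b = - a is a scale of the symmetric difference, and the absolute value at 0
    separates the symmetric from the ordinary derivative. *)
Require Import Defs.
From mathcomp Require Import all_boot all_order all_algebra.
From mathcomp Require Import all_classical all_reals all_analysis.
From mathcomp Require Import ring lra.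

Import Order.TTheory GRing.Theory Num.Theory.
Import numFieldNormedType.Exports.

Local Open Scope classical_set_scope.
Local Open Scope ring_scope.

(** Scaling by [r^-1] undoes scaling by [r], so the scale of [A] itself serves as the witness [B],
    and only its nodes have to be compared with the Gaussian lists. *)
Lemma gaussian_of_scale (R : realType) n (A : grdiff R n) (q r : R)
    (hr : r != 0) :
  without_excess A -> [/\ q <> 0, q <> 1 & q <> - 1] ->
  based_at (scale hr A) (0 :: mkseq (fun i => q ^+ i) n) \/
    based_at (scale hr A) (mkseq (fun i => q ^+ i) n.+1) ->
  gaussian A.
Proof.
move=> wA hq bA; exists q; split=> //; exists (scale hr A); split=> //.
have hr' : r^-1 != 0 by rewrite invr_eq0.
exists r^-1, hr'; exists id; first by exists id.
move=> k /=; split; last by rewrite mulrA mulVf ?mul1r.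
by rewrite exprVn invrK mulrA mulfV ?mul1r // expf_neq0.
Qed.

Lemma codom_ord2 (T : eqType) (g : 'I_2 -> T) : codom g =i [:: g 0; g 1].
Proof.
move=> y; rewrite !inE; apply/codomP/orP.
  case=> i ->; case: (unliftP ord0 i) => [j|] ->; last by left.
  by right; rewrite (ord1 j); apply/eqP; congr g; apply/val_inj.
by case=> /eqP->; eexists.
Qed.

(** For [h != 0] the two estimates differ by the factor [|h|]. The little-o bound also speaks of
    [h = 0], where [g 0 = 0] makes it trivial. *)
Lemma littleo_id_cvg (R : realType) (g : R -> R) (l : R) : g 0 = 0 ->
  ((fun h => g h - l * h) =o_ (0 : R) (fun h : R => h)) <->
  (fun h => g h / h) @ 0^' --> l.
Proof.
move=> g0.
have E (h : R) : h != 0 -> `|l - g h / h| * `|h| = `|g h - l * h|.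
  by move=> h0; rewrite -normrM mulrBl divfK // distrC.
split=> [/eqoP H|/cvgrPdist_le H].
  apply/cvgrPdist_le => e e0; have := H e e0.
  rewrite near_withinE; apply: filterS => h /= He h0.
  by rewrite -(@ler_pM2r _ `|h|) ?normr_gt0 // E.
apply/eqoP => e e0; have := H e e0.
rewrite near_withinE; apply: filterS => h /= He.
have [->|h0] := eqVneq h 0; first by rewrite g0 mulr0 subrr !normr0 mulr0.
by rewrite -E // ler_wpM2r // He.
Qed.

Lemma scale_cvg_dnbhs0 (R : realType) (a : R) : a != 0 ->
  (fun h => a * h) @ 0^' --> 0^'.
Proof.
move=> a0 P; rewrite /= /dnbhs /within /= => HP.
have : (fun h : R => a * h) @ (0 : R) --> a * 0 by exact: mulrl_continuous.
rewrite mulr0 => /(_ _ HP) H; apply: (@filterS _ (nbhs (0 : R)) _ _ _ _ H).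
by move=> h /= Ph h0; apply: Ph; rewrite mulf_neq0.
Qed.

(** Both [h => a * h] and its inverse preserve punctured neighbourhoods of 0, so the variable of a
    limit at 0 may be rescaled freely. *)
Lemma cvg_dnbhs0_scale (R : realType) (g : R -> R) (a l : R) : a != 0 ->
  (fun h => g (a * h)) @ 0^' --> l <-> g @ 0^' --> l.
Proof.
move=> a0; have a0' : a^-1 != 0 by rewrite invr_eq0.
split=> H; last exact: (cvg_comp (fun h => a * h) g (scale_cvg_dnbhs0 _ _ a0) H).
have := cvg_comp (fun h => a^-1 * h) (fun h => g (a * h)) (scale_cvg_dnbhs0 _ _ a0') H.
rewrite (_ : (fun h => _ (a * h)) \o _ = g) //.
by apply/funext => h /=; rewrite mulVKf.
Qed.

Lemma two_nodes_not_gaussian (R : realType) (A : grdiff R 1) :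
  without_excess A -> ~ gaussian A ->
  exists2 a : R, a != 0 & forall x h f,
    Delta A x h f = (f (x + a * h) - f (x - a * h)) / (2 * a).
Proof.
case: A => l c a c0 ai m wA; have wA' := wA; rewrite /without_excess /= in wA'.
subst l => nG; set A := GRDiff _ _ _ in wA nG.
have a01 : a 0 != a 1 by apply/negP => /eqP/ai.
have scaled (r : R) (hr : r != 0) : codom (node (scale hr A)) =i
    [:: r * a 0; r * a 1] by exact: codom_ord2.
have a0n0 : a 0 != 0.
  apply/negP => /eqP a00; have a1n0 : (a 1)^-1 != 0.
    by move: a01; rewrite a00 eq_sym invr_eq0.
  (* The scale has nodes 0 and 1. In order 1 the list starting with 0 contains no power of [q] but
     [q ^+ 0], so 2 is an arbitrary admissible choice. *)
  apply: nG; apply: (@gaussian_of_scale _ _ _ 2 _ a1n0) => //.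
    by split=> E; lra.
  left=> y; rewrite scaled a00 mulr0 mulVf //.
  by rewrite -invr_eq0.
have a1n0 : a 1 != 0.
  apply/negP => /eqP a10; have a0n0' : (a 0)^-1 != 0 by rewrite invr_eq0.
  apply: nG; apply: (@gaussian_of_scale _ _ _ 2 _ a0n0') => //.
    by split=> E; lra.
  by left=> y; rewrite scaled a10 mulr0 mulVf // !inE orbC.
have a1E : a 1 = - a 0.
  apply: contrapT => a1N; have a0n0' : (a 0)^-1 != 0 by rewrite invr_eq0.
  (* Dividing by [a 0] gives the nodes 1 and [q = a 1 / a 0]. Here [q] avoids 0 since [a 1 != 0], 1
     since the nodes differ, and -1 by the assumption [a1N]. *)
  apply: nG; apply: (@gaussian_of_scale _ _ _ (a 1 / a 0) _ a0n0') => //.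
    have E : a 1 = a 1 / a 0 * a 0 by rewrite divfK.
    split=> q.
    - by move: a1n0; rewrite E q mul0r eqxx.
    - by move: a01; rewrite E q mul1r eqxx.
    - by apply: a1N; rewrite E q mulN1r.
  by right=> y; rewrite scaled mulVf // mulrC.
have sum2 (F : 'I_2 -> R) : \sum_k F k = F 0 + F 1.
  by rewrite big_ord_recl big_ord1; congr (_ + F _); apply/val_inj.
exists (a 0) => // x h f.
have := m 0%N isT; have := m 1%N isT; rewrite !sum2 /= !expr0 !expr1 !mulr1.
rewrite /Delta sum2 /= a1E mulNr => m1 m0.
(* The zeroth moment makes the coefficients opposite; the first moment then reads
   [c 0 * (2 * a 0) = 1]. *)
have c1E : c 1 = - c 0 by lra.
have c0E : c 0 = (2 * a 0)^-1.
  apply: (mulIf (x := 2 * a 0)); first by rewrite mulf_neq0 // pnatr_eq0.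
  by rewrite mulVf ?mulf_neq0 ?pnatr_eq0 //; move: m1; rewrite c1E factS fact0; lra.
by rewrite c1E c0E mulNr -mulrBr mulrC.
Qed.

(** With tolerance 1/2, a small positive increment forces [c 1 >= 1/2], while the opposite increment
    forces [c 1 <= -1/2]. *)
Lemma norm_not_peano1 (R : realType) : ~ peano_exists 1 (@Num.norm R R) 0.
Proof.
case=> c [c0 /eqoP /(_ 2^-1)]; rewrite invr_gt0 ltr0n => /(_ isT).
rewrite normr0 in c0.
move=> /nbhs_ballP[e /= e0] H.
have e2 : 0 < e / 2 by lra.
have := H (e / 2); have := H (- (e / 2)).
rewrite /ball /= !sub0r !normrN !(gtr0_norm e2) => /(_ ltac:(lra)) Hm /(_ ltac:(lra)).
move: Hm; rewrite !big_ord_recl !big_ord0 /= !c0 !mul0r !add0r !addr0 /bump /=.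
rewrite addn0 factS fact0 !divr1 !expr1 (gtr0_norm e2) !ler_norml.
move=> /andP[h1 h2] /andP[h3 h4]; lra.
Qed.

Theorem proposition2p2 (R : realType) (A : grdiff R 1) :
  without_excess A -> ~ gaussian A ->
  (forall (f : R -> R) (x L : R), is_grderiv A f x L <-> is_sym_peano1 f x L) /\
  (exists (f : R -> R) (x : R),
     [/\ peano_exists 0 f x,
         (exists L : R, is_grderiv A f x L)
       & ~ peano_exists 1 f x]).
Proof.
move=> wA nG; have [a a0 DE] := two_nodes_not_gaussian _ _ wA nG; split.
  move=> f x L; rewrite /is_sym_peano1 littleo_id_cvg; last first.
    by rewrite addr0 subr0 subrr mulr0.
  (* After replacing [h] by [a * h], the symmetric quotient coincides with that of [A]. *)
  rewrite -(cvg_dnbhs0_scale _ _ _ _ a0) /is_grderiv.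
  suff -> : (fun h => Delta A x h f / h ^+ 1) =
      (fun h => 2^-1 * (f (x + a * h) - f (x - a * h)) / (a * h)) by [].
  by apply/funext => h; rewrite DE expr1 !invfM; ring.
exists (@Num.norm R R), 0; split; last exact: norm_not_peano1.
  (* Since [h ^+ 0 = 1], the claim is continuity of the absolute value at 0, and the radius can
     equal the tolerance. *)
  exists (fun=> 0); split; first by rewrite normr0.
  apply/eqoP => e e0; apply/nbhs_ballP; exists e => //= h.
  rewrite /ball /= sub0r normrN big_ord1 mul0r subr0 add0r normr_id expr0 normr1.
  by rewrite mulr1 => /ltW.
(* The absolute value is even, so its symmetric difference at 0 vanishes identically. *)
exists 0; rewrite /is_grderiv (_ : (fun h => _) = fun=> 0); first exact: cvg_cst.
by apply/funext => h; rewrite DE add0r sub0r normrN subrr !mul0r.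
Qed.
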